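(* For every integer $k \geq 2$, $s(k^2-1) = k$.
   Context: For a positive integer $N$, $s(N)$ denotes the smallest side length of a square containing $N$ unit squares (closed squares of side length $1$) with pairwise disjoint interiors, where the unit squares may be translated and rotated independently. *)

(* Defs.v *)
From mathcomp Require Import all_boot all_order all_algebra.
From mathcomp Require Import all_classical all_reals all_analysis.

Set Implicit Arguments.
Unset Strict Implicit.
Unset Printing Implicit Defensive.

Import Order.TTheory GRing.Theory Num.Theory.
Import numFieldNormedType.Exports.

Local Open Scope classical_set_scope.
Local Open Scope ring_scope.

(* The closed square of side length [l] with a corner at [p], obtained from
   [0, l] x [0, l] by the rotation of angle [t] followed by the translation
   by [p]; every square of the plane has this form. *)
Definition square (R : realType) (l : R) (p : R * R) (t : R) : set (R * R) :=
  [set q : R * R | exists u v : R,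
     [/\ 0 <= u <= l, 0 <= v <= l &
         q = (p.1 + (u * cos t - v * sin t), p.2 + (u * sin t + v * cos t))]].

(* [interior] is taken in the product topology of the plane [R * R]. *)
Definition packable (R : realType) (N : nat) (l : R) : Prop :=
  exists (P : R * R) (T : R) (p : 'I_N -> R * R) (t : 'I_N -> R),
    (forall i, square 1 (p i) (t i) `<=` square l P T) /\
    trivIset [set: 'I_N] (fun i => interior (square 1 (p i) (t i))).

Definition side_lengths (R : realType) (N : nat) : set R :=
  [set l : R | 0 < l /\ packable N l].

(* The least element of [side_lengths R N]. The default value 0 is returned if
   there is no least element; 0 is not a member of [side_lengths R N], so
   [s R N = l] with [0 < l] does assert that the minimum exists and is [l]. *)
Definition s (R : realType) (N : nat) : R :=
  xget 0 (@side_lengths R N `&` lbound (@side_lengths R N)).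

(* Main.v *)
(* Slice the container, of side W < k, by horizontal lines: the chords of the
   squares on a line have total length at most W, so the area wasted below a
   given height is the integral of the unused lengths. On the line at height
   h = 4/5 a square either has a chord of length at least 1, and there are at
   most k - 1 of these, or its part below the line is a small right triangle of
   area at most 1/4 of its chord. Hence the bottom strip of height h wastes at
   least (h - 1/4) (W - k + 1), and so does the top strip. Altogether
   N <= W^2 - 11/10 (W - k + 1) < k^2 - 1. *)

Require Import Defs.
From mathcomp Require Import all_boot all_order all_algebra.
From mathcomp Require Import all_classical all_reals all_analysis.
From mathcomp Require Import ring lra.

Set Implicit Arguments.
Unset Strict Implicit.
Unset Printing Implicit Defensive.

Import Order.TTheory GRing.Theory Num.Theory.
Import numFieldNormedType.Exports.
Local Open Scope classical_set_scope.
Local Open Scope ring_scope.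

(** * Chord and area profile of one tilted unit square *)

Section profile.
Variable R : realFieldType.
Implicit Types c s z d h : R.

Definition ramp z := Num.max z 0.

Lemma rampN z : ramp (- z) = ramp z - z.
Proof. by rewrite /ramp; case: (leP z 0) => ?; case: (leP (- z) 0) => ?; lra. Qed.

(** [ramp z ^+ 2] is convex with derivative [2 * ramp z], so it lies above its tangents; its second
    derivative is at most 2, whence the quadratic term in the next lemma. *)
Lemma ramp_sqr_ge z d : 0 <= d -> ramp z ^+ 2 + 2 * ramp z * d <= ramp (z + d) ^+ 2.
Proof.
by rewrite /ramp; case: (leP z 0) => ?; case: (leP (z + d) 0) => ? ?; nra.
Qed.

Lemma ramp_sqr_le z d : 0 <= d ->
  ramp (z + d) ^+ 2 <= ramp z ^+ 2 + 2 * ramp z * d + d ^+ 2.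
Proof.
by rewrite /ramp; case: (leP z 0) => ?; case: (leP (z + d) 0) => ? ?; nra.
Qed.

(* For the unit square with sides directed by (c, s) and (- s, c), where c and s
   are positive, [chord c s z] is the length of the horizontal chord at height z
   above the lowest corner and [cap c s z] the area of the part below it. *)
Definition chord c s z :=
  Num.max 0 (Num.min (Num.min s c) (Num.min z (s + c - z))) / (s * c).

Definition cap c s z :=
  (ramp z ^+ 2 - ramp (z - s) ^+ 2 - ramp (z - c) ^+ 2
   + ramp (z - s - c) ^+ 2) / (2 * (s * c)).

Lemma chordC c s z : chord c s z = chord s c z.
Proof. by rewrite /chord (minC s) (addrC s) (mulrC s). Qed.

Lemma capC c s z : cap c s z = cap s c z.
Proof. by rewrite /cap (mulrC s) (addrAC z) [_ ^+ 2 - _ - _]addrAC. Qed.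

(** Up to the factor [s * c], the trapezoid changes slope by 1, -1, -1, 1 at [0], [s], [c], [s + c].
    This form shows that [chord] is the derivative of [cap] in [z]. *)
Lemma chordE c s z : 0 < c -> 0 < s ->
  chord c s z = (ramp z - ramp (z - s) - ramp (z - c) + ramp (z - s - c)) / (s * c).
Proof.
wlog sc : c s / s <= c.
  move=> H c0 s0; case: (leP s c) => sc; first exact: H.
  rewrite chordC H ?ltW// (mulrC c); congr (_ / _).
  by rewrite (addrAC z) [ramp z - _ - _]addrAC.
move=> c0 s0; rewrite /chord (min_l sc); congr (_ / _); rewrite /ramp.
case: (leP z 0) => z0.
  rewrite [Num.min z _]min_l ?[Num.min s _]min_r ?[Num.max 0 _]max_l; try lra.
  by rewrite !max_r; lra.
case: (leP z s) => zs.
  rewrite [Num.min z _]min_l ?[Num.min s _]min_r ?[Num.max 0 _]max_r; try lra.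
  by rewrite !max_r; lra.
rewrite [Num.max (z - s) 0]max_l; last lra.
case: (leP z c) => zc.
  rewrite [Num.min s _]min_l; last by rewrite le_min; apply/andP; split; lra.
  rewrite [Num.max 0 _]max_r; last lra.
  by rewrite !max_r; lra.
rewrite [Num.max (z - c) 0]max_l; last lra.
rewrite [Num.min z _]min_r ?[Num.min s _]min_r; try lra.
case: (leP z (s + c)) => zsc.
  by rewrite !max_r; lra.
by rewrite [LHS]max_l ?[Num.max _ 0]max_l; lra.
Qed.

Lemma chord_ge0 c s z : 0 < c -> 0 < s -> 0 <= chord c s z.
Proof.
move=> c0 s0; rewrite /chord divr_ge0 ?le_max ?lexx//.
by rewrite mulr_ge0// ltW.
Qed.

Lemma chord_sym c s z : chord c s (s + c - z) = chord c s z.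
Proof. by rewrite /chord opprB addrCA subrr addr0 [Num.min (_ - _) _]minC. Qed.

(** A half turn about the centre exchanges the part above height [z] with the part below
    [s + c - z]. *)
Lemma cap_sym c s z : 0 < c -> 0 < s -> cap c s (s + c - z) = 1 - cap c s z.
Proof.
move=> c0 s0; rewrite /cap.
have -> : s + c - z = - (z - s - c) by ring.
have -> : - (z - s - c) - s = - (z - c) by ring.
have -> : - (z - s - c) - c = - (z - s) by ring.
have -> : - (z - c) - c = - z by ring.
rewrite !rampN; set A := ramp z; set B := ramp (z - s); set C := ramp (z - c).
set D := ramp (z - s - c).
(* This relation reduces [(ramp x - x) ^+ 2] to [x ^+ 2 - ramp x ^+ 2]; the four squares free of
   [ramp] then combine to [2 * (s * c)]. *)
have H x : ramp x * (ramp x - x) = 0.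
  by rewrite /ramp; case: (leP x 0) => ?; ring.
have hA : A * (A - z) = 0 by exact: H.
have hB : B * (B - (z - s)) = 0 by exact: H.
have hC : C * (C - (z - c)) = 0 by exact: H.
have hD : D * (D - (z - s - c)) = 0 by exact: H.
have h : s * c != 0 by rewrite mulf_neq0// gt_eqF.
have h2 : 2 * (s * c) != 0 by rewrite mulf_neq0// pnatr_eq0.
by apply: (mulIf h2); rewrite mulrBl !mulfVK//; lra.
Qed.

(** First-order expansion with derivative [chord]. The two ramps of positive sign in [cap] each
    contribute [d ^+ 2 / (2 * (s * c))] to the error; the other two contribute nothing, by
    convexity. *)
Lemma cap_incr c s z d : 0 < c -> 0 < s -> 0 <= d ->
  cap c s (z + d) <= cap c s z + chord c s z * d + d ^+ 2 / (s * c).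
Proof.
move=> c0 s0 d0; rewrite chordE// /cap.
have sc0 : 0 < s * c by exact: mulr_gt0.
have := ramp_sqr_le z d0; have := ramp_sqr_ge (z - s) d0.
have := ramp_sqr_ge (z - c) d0; have := ramp_sqr_le (z - s - c) d0.
rewrite !(addrAC z d) !(addrAC (z - s) d).
set A := ramp z; set B := ramp (z - s); set C := ramp (z - c).
set D := ramp (z - s - c).
set A' := ramp (z + d); set B' := ramp (z - s + d); set C' := ramp (z - c + d).
set D' := ramp (z - s - c + d) => h1 h2 h3 h4.
rewrite ler_pdivrMr ?mulr_gt0// ?ltr0n//.
have -> : ((A ^+ 2 - B ^+ 2 - C ^+ 2 + D ^+ 2) / (2 * (s * c)) +
  (A - B - C + D) / (s * c) * d + d ^+ 2 / (s * c)) * (2 * (s * c)) =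
  A ^+ 2 - B ^+ 2 - C ^+ 2 + D ^+ 2 + 2 * (A - B - C + D) * d + 2 * d ^+ 2.
  by field; rewrite ?gt_eqF.
lra.
Qed.

Lemma cap_le0 c s z : 0 < c -> 0 < s -> z <= 0 -> cap c s z = 0.
Proof.
move=> c0 s0 z0; rewrite /cap /ramp.
by rewrite !max_r; [rewrite expr0n/= !subr0 addr0 mul0r|lra..].
Qed.

(* If the chord z / (sc) is less than 1 then the part below it is a triangle of
   area z / 2 times the chord, and z < sc <= 1/2, whence the 1/4. Any constant up
   to min (c + s - sc) = sqrt 2 - 1/2 would do instead of 4/5. *)
Lemma cap_bottom c s z : 0 < c -> 0 < s -> c ^+ 2 + s ^+ 2 = 1 -> z <= 4 / 5 ->
  cap c s z <= 4 / 5 /\ (1 <= chord c s z \/ cap c s z <= chord c s z / 4).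
Proof.
wlog sc : c s / s <= c.
  move=> H c0 s0 e z1; case: (leP s c) => sc; first exact: H.
  by rewrite chordC capC; apply: H => //; [exact: ltW|rewrite addrC].
move=> c0 s0 e z1.
have scp : 0 < s * c by exact: mulr_gt0.
have c1 : c < 1 by nra.
have s1 : s < 1 by nra.
have cs1 : 1 < s + c by nra.
case: (leP z 0) => z0.
  rewrite cap_le0//; split; first lra.
  by right; rewrite divr_ge0// chord_ge0.
rewrite chordE// /cap /ramp [Num.max (z - s - c) 0]max_r ?[Num.max z 0]max_l; try lra.
case: (leP (z - s) 0) => zs.
  rewrite [Num.max (z - c) 0]max_r; last lra.
  rewrite expr0n/= !subr0 !addr0; split.
    by rewrite ler_pdivrMr ?mulr_gt0// ?ltr0n//; nra.
  case: (leP (s * c) z) => h; [left|right].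
    by rewrite ler_pdivlMr// mul1r.
  rewrite ler_pdivrMr ?mulr_gt0// ?ltr0n//.
  have -> : z / (s * c) / 4 * (2 * (s * c)) = z / 2 by field; rewrite !gt_eqF.
  have : s * c <= 1 / 2 by nra.
  nra.
case: (leP (z - c) 0) => zc.
  rewrite expr0n/= !subr0 !addr0; split.
    rewrite ler_pdivrMr ?mulr_gt0// ?ltr0n//.
    (* The area is [(z - s / 2) / c] here. Since [z <= c], the bound [c * (1 - c) <= s / 2] makes it
       at most [z]. *)
    suff : z - s / 2 <= c * z by nra.
    have : c * (1 - c) <= s / 2 by nra.
    nra.
  by left; rewrite ler_pdivlMr// mul1r; nra.
rewrite expr0n/= !addr0; split.
  rewrite ler_pdivrMr ?mulr_gt0// ?ltr0n//.
  have : s * c / 2 <= s + c - 1 by nra.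
  nra.
left; rewrite ler_pdivlMr// mul1r.
(* The chord [(s + c - z) / (s * c)] is at least 1 exactly when [(1 - c) * (1 - s) <= 1 - z]. *)
have : (1 - c) * (1 - s) <= 1 / 5 by nra.
nra.
Qed.

End profile.

(** * Slicing a packing by horizontal lines *)

Section packing.
Variable R : realType.

(** Additivity of Lebesgue measure on disjoint intervals inside [[0, W]]. Length 0 is allowed, for
    squares that the line misses. *)
Lemma sum_disjoint_itv n (lo len : 'I_n -> R) (W : R) :
  0 <= W -> (forall i, 0 <= len i) ->
  (forall i x, lo i < x < lo i + len i -> 0 <= x <= W) ->
  (forall i j x, lo i < x < lo i + len i -> lo j < x < lo j + len j -> i = j) ->
  \sum_i len i <= W.
Proof.
move=> W0 len0 sub disj.
pose I (i : 'I_n) : set R := `]lo i, lo i + len i[%classic.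
have mI i : measurable (I i) by exact: measurable_itv.
have tI : trivIset setT I.
  move=> i j _ _ [x []]; rewrite /I /= !in_itv/= => xi xj.
  exact: disj xi xj.
have muI i : lebesgue_measure (I i) = (len i)%:E.
  rewrite lebesgue_measure_itv/= lte_fin ltrDl; case: ltP => h.
    by rewrite -EFinD addrAC subrr add0r.
  by congr (_%:E); apply/eqP; rewrite eq_le h len0.
rewrite -lee_fin -sumEFin; under eq_bigr do rewrite -muI.
rewrite -measure_bigsetU_ord//.
have -> : W%:E = lebesgue_measure (`[0%R, W]%classic : set R).
  rewrite lebesgue_measure_itv/= lte_fin; case: ltP => h.
    by rewrite -EFinD subr0.
  by congr (_%:E); apply/eqP; rewrite eq_le h W0.
apply: le_measure; rewrite ?inE//.
  by apply: bigsetU_measurable => i _; exact: mI.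
apply: (big_ind (fun A : set R => A `<=` `[0, W]%classic)).
- exact: sub0set.
- by move=> A B sA sB; rewrite subUset; split.
- by move=> i _ x; rewrite /I /= !in_itv/=; exact: sub.
Qed.

(* With K the sum of the 1 / (sc), this bounds the area between two heights by
   the integral of the chords, without differentiating [cap]. *)
Lemma le_of_quadratic_increment (f : R -> R) (W K a b : R) : a <= b ->
  (forall x d, 0 <= d -> f (x + d) <= f x + W * d + K * d ^+ 2) ->
  f b - f a <= W * (b - a).
Proof.
move=> ab fK.
have step n d : 0 <= d -> f (a + d *+ n) <= f a + (W * d + K * d ^+ 2) *+ n.
  move=> d0; elim: n => [|n IH]; first by rewrite !mulr0n !addr0.
  rewrite !mulrSr !addrA; apply: le_trans (fK _ _ d0) _.
  by lra.
apply/ler_addgt0Pr => e e0.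
(* Over [n.+1] equal steps the error adds up to [K * (b - a) ^+ 2 / n.+1]; [n] is chosen to bring it
   below [e]. *)
have [n hn] : exists n, `|K| * (b - a) ^+ 2 / e < n.+1%:R.
  by eexists; exact: truncnS_gt.
have n1 : 0 < n.+1%:R :> R by rewrite ltr0n.
have := step n.+1 ((b - a) / n.+1%:R).
have d0 : 0 <= (b - a) / n.+1%:R by rewrite divr_ge0 ?subr_ge0.
move=> /(_ d0).
rewrite -[_ *+ n.+1]mulr_natr mulfVK ?gt_eqF// addrC subrK.
rewrite -[_ *+ n.+1]mulr_natr.
set d := (b - a) / n.+1%:R.
have dn : d * n.+1%:R = b - a by rewrite mulfVK ?gt_eqF.
have -> : (W * d + K * d ^+ 2) * n.+1%:R = W * (b - a) + K * (b - a) * d.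
  by rewrite -dn; ring.
have : K * (b - a) * d <= e.
  apply: le_trans (_ : `|K| * (b - a) ^+ 2 / n.+1%:R <= e).
    rewrite /d mulrA ler_pM2r ?invr_gt0// -mulrA -expr2.
    by rewrite ler_wpM2r ?sqr_ge0// ler_norm.
  by rewrite ler_pdivrMr// [e * _]mulrC -ler_pdivrMr// ltW.
lra.
Qed.

(* The open unit square with corner [p] and sides directed by (c, s) and (- s, c). *)
Definition osquare (p : R * R) (c s : R) : set (R * R) :=
  [set q | 0 < (q.1 - p.1) * c + (q.2 - p.2) * s < 1 /\
           0 < (q.2 - p.2) * c - (q.1 - p.1) * s < 1].

Lemma osquare_slice p c s y : 0 < c -> 0 < s -> c ^+ 2 + s ^+ 2 = 1 ->
  exists lo, forall x, lo < x < lo + chord c s (y - p.2) -> osquare p c s (x, y).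
Proof.
move=> c0 s0 e; set z := y - p.2.
(* The left end is the larger of the lower bounds on [x - p.1] that come from
   [0 < (x - p.1) * c + z * s] and [z * c - (x - p.1) * s < 1]. *)
exists (p.1 + Num.max (- (z * s) / c) ((z * c - 1) / s)) => x /andP[h1 h2].
set m := Num.max _ _ in h1 h2.
have m1 : - (z * s) <= m * c by rewrite -ler_pdivrMr// le_max lexx.
have m2 : z * c - 1 <= m * s by rewrite -ler_pdivrMr// le_max lexx orbT.
have m3 : m * c = - (z * s) \/ m * s = z * c - 1.
  by rewrite /m; case: leP => _; [right|left]; rewrite mulfVK ?gt_eqF.
have sc0 : 0 < s * c by exact: mulr_gt0.
have : (x - p.1 - m) * (s * c) < Num.min (Num.min s c) (Num.min z (s + c - z)).
  have : x - p.1 - m < chord c s z by lra.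
  rewrite /chord ltr_pdivlMr// lt_max => /orP[|//].
  by rewrite pmulr_llt0//; lra.
have : 0 < x - p.1 - m by lra.
rewrite !lt_min => u0 /andP[/andP[us uc] /andP[uz uz']].
have v1 : (x - p.1 - m) * c < 1 by nra.
have v2 : (x - p.1 - m) * s < 1 by nra.
rewrite /osquare/= -/z; move: us uc uz uz' u0 v1 v2; set u := x - p.1 - m.
have -> : x - p.1 = u + m by rewrite /u subrK.
move=> us uc uz uz' u0 v1 v2; have k1 : 0 < u * c by exact: mulr_gt0.
have k2 : 0 < u * s by exact: mulr_gt0.
(* According to the side on which the left end lies, one of the two remaining bounds follows from
   [v1] or [v2], the other from [w], which rests on [uz] or [uz']. *)
case: m3 => m3.
  have w : (u + m) * s * c < z * c ^+ 2.
    have -> : c ^+ 2 = 1 - s ^+ 2 by lra.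
    have -> : (u + m) * s * c = u * (s * c) + m * c * s by ring.
    by rewrite m3; lra.
  by split; apply/andP; split; [lra|lra|nra|lra].
have w : (u + m) * c * s < (1 - z * s) * s.
  have -> : (u + m) * c * s = u * (s * c) + m * s * c by ring.
  rewrite m3; have : z * c ^+ 2 + z * s ^+ 2 = z by rewrite -mulrDr e mulr1.
  lra.
have w' : (u + m) * c < 1 - z * s by rewrite -(ltr_pM2r s0).
by split; apply/andP; split; lra.
Qed.
End packing.

(** * Counting squares by wasted area *)

Section count.
Variable R : realType.

Lemma osquare_pt (p : R * R) c s a b : c ^+ 2 + s ^+ 2 = 1 -> 0 < a < 1 -> 0 < b < 1 ->
  osquare p c s (p.1 + (a * c - b * s), p.2 + (a * s + b * c)).
Proof.
move=> e ha hb; rewrite /osquare/= !(addrC p.1) !(addrC p.2) !addrK.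
have -> : (a * c - b * s) * c + (a * s + b * c) * s = a.
  by rewrite -[RHS]mulr1 -e; ring.
have -> // : (a * s + b * c) * c - (a * c - b * s) * s = b.
by rewrite -[RHS]mulr1 -e; ring.
Qed.

(** The lowest and highest vertices are not in the open square, so they are approached along the
    diagonal through [p]. *)
Lemma osquare_height (p : R * R) c s W : 0 < c -> 0 < s -> c ^+ 2 + s ^+ 2 = 1 ->
  (forall q, osquare p c s q -> 0 <= q.2 <= W) -> 0 <= p.2 /\ p.2 + (s + c) <= W.
Proof.
move=> c0 s0 e H.
have sc2 : s + c <= 2 by have := sqr_ge0 (s - 1); have := sqr_ge0 (c - 1); nra.
have P d : 0 < d < 1 -> 0 <= p.2 + d * (s + c) <= W.
  by move=> hd; rewrite mulrDr; have := H _ (osquare_pt p e hd hd).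
split; apply/ler_addgt0Pr => d d0.
  case: (ltP d 2) => hd.
    have /P/andP[] : 0 < d / 2 < 1 by apply/andP; split; lra.
    nra.
  have /P/andP[] : 0 < (1 / 2 : R) < 1 by apply/andP; split; lra.
  nra.
case: (ltP d 2) => hd.
  have /P/andP[] : 0 < 1 - d / 2 < 1 by apply/andP; split; lra.
  nra.
have /P/andP[] : 0 < (1 / 2 : R) < 1 by apply/andP; split; lra.
nra.
Qed.

(** Chords of length at least 1 number at most [k - 1], since their total is below [k]. Each of them
    costs at most [4 / 5 <= 11 / 20 + len / 4], and every other chord at most [len / 4]. *)
Lemma strip_bound N (k : nat) (W : R) (len A : 'I_N -> R) : (0 < k)%N ->
  (forall i, 0 <= len i) -> \sum_i len i <= W -> W < k%:R ->
  (forall i, A i <= 4 / 5 /\ (1 <= len i \/ A i <= len i / 4)) ->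
  \sum_i A i <= 11 / 20 * (k%:R - 1) + W / 4.
Proof.
move=> k0 len0 lenW Wk HA.
have hA : \sum_i A i <= 11 / 20 * \sum_i (1 <= len i)%R%:R + (\sum_i len i) / 4.
  rewrite mulr_sumr mulr_suml -big_split/=; apply: ler_sum => i _.
  have [h1 h2] := HA i.
  case: (leP 1 (len i)) => h /=; first lra.
  by case: h2 => h2; lra.
have : \sum_i (1 <= len i)%R%:R <= k%:R - 1 :> R.
  rewrite -natr_sum -(prednK k0) -natr1 addrK ler_nat -ltnS (prednK k0) -(ltr_nat R).
  apply: le_lt_trans Wk; apply: le_trans lenW.
  rewrite natr_sum; apply: ler_sum => i _.
  by case: (leP 1 (len i)).
lra.
Qed.

Lemma packing_bound N k (W : R) (p : 'I_N -> R * R) (c s : 'I_N -> R) :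
  (2 <= k)%N -> 0 <= W -> W < k%:R ->
  (forall i, [/\ 0 < c i, 0 < s i & c i ^+ 2 + s i ^+ 2 = 1]) ->
  (forall i q, osquare (p i) (c i) (s i) q -> 0 <= q.1 <= W /\ 0 <= q.2 <= W) ->
  (forall i j q, osquare (p i) (c i) (s i) q -> osquare (p j) (c j) (s j) q -> i = j) ->
  N%:R < k%:R ^+ 2 - 1 :> R.
Proof.
move=> k2 W0 Wk cs sub disj.
have k2' : 2 <= k%:R :> R by rewrite ler_nat.
have c0 i : 0 < c i by case: (cs i).
have s0 i : 0 < s i by case: (cs i).
have cs1 i : c i ^+ 2 + s i ^+ 2 = 1 by case: (cs i).
have height i : 0 <= (p i).2 /\ (p i).2 + (s i + c i) <= W.
  by apply: osquare_height => // q /sub[].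
pose len y i := chord (c i) (s i) (y - (p i).2).
pose A y i := cap (c i) (s i) (y - (p i).2).
have len0 y i : 0 <= len y i by exact: chord_ge0.
have lenW y : \sum_i len y i <= W.
  have /choice[lo hlo] i := osquare_slice (p i) y (c0 i) (s0 i) (cs1 i).
  apply: (sum_disjoint_itv (lo := lo)) => //.
    by move=> i x /hlo/sub[].
  by move=> i j x /hlo hi /hlo; exact: disj hi.
have area a b : a <= b -> \sum_i A b i - \sum_i A a i <= W * (b - a).
  move=> ab.
  apply: (@le_of_quadratic_increment R (fun y => \sum_i A y i) W
    (\sum_i (s i * c i)^-1)) => // y d d0.
  apply: (@le_trans _ _ (\sum_i A y i + (\sum_i len y i) * d +
    (\sum_i (s i * c i)^-1) * d ^+ 2)); last first.
    by rewrite lerD2r lerD2l ler_wpM2r.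
  rewrite !mulr_suml -!big_split/=; apply: ler_sum => i _.
  have := cap_incr (y - (p i).2) (c0 i) (s0 i) d0.
  by rewrite /A /len (addrAC y d) [_^-1 * _]mulrC.
have capT z i : cap (c i) (s i) (s i + c i - z) = 1 - cap (c i) (s i) z.
  exact: cap_sym.
have sumT y : \sum_i (1 - A y i) = N%:R - \sum_i A y i.
  by rewrite sumrB sumr_const card_ord.
have A0 i : A 0 i = 0 by apply: cap_le0 => //; have [] := height i; lra.
have AW i : A W i = 1.
  rewrite /A -[W - _](subKr (s i + c i)) capT cap_le0 ?subr0//.
  by have [] := height i; lra.
have NW : N%:R <= W ^+ 2.
  have := area 0 W W0.
  rewrite (eq_bigr (fun=> 1)) ?sumr_const ?card_ord//.
  by rewrite big1// !subr0 expr2.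
(* Below [8 / 5] the two strips would overlap, but then [N <= W ^+ 2 < 3 <= k ^+ 2 - 1]. *)
case: (ltP W (8 / 5)) => W2; first nra.
have bot : \sum_i A (4 / 5) i <= 11 / 20 * (k%:R - 1) + W / 4.
  apply: (@strip_bound N k W (len (4 / 5))) => //; first by rewrite (leq_trans _ k2).
  by move=> i; apply: cap_bottom => //; have [] := height i; lra.
have top : \sum_i (1 - A (W - 4 / 5) i) <= 11 / 20 * (k%:R - 1) + W / 4.
  apply: (@strip_bound N k W (len (W - 4 / 5))) => //; first by rewrite (leq_trans _ k2).
  (* The half turn of each square reduces the top strip to [cap_bottom]. *)
  move=> i; rewrite /len /A -capT -chord_sym; apply: cap_bottom => //.
  by have [] := height i; lra.
have mid := area (4 / 5) (W - 4 / 5).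
have {}mid : \sum_i A (W - 4 / 5) i - \sum_i A (4 / 5) i <= W * (W - 8 / 5).
  by apply: le_trans (mid _) _; lra.
rewrite sumT in top.
(* [w ^+ 2 - 11 / 10 * w] increases for [w >= 11 / 20]. The three areas then add up to less than
   [k ^+ 2 - 11 / 10]. *)
have : W ^+ 2 - 11 / 10 * W < k%:R ^+ 2 - 11 / 10 * k%:R by nra.
nra.
Qed.

End count.

(** * From closed squares at any angle to tilted open squares *)

Section reduction.
Variable R : realType.
Implicit Types (p q x P : R * R) (c s r l t T : R).

(** The same square described from its next corner, with the frame turned by a right angle. *)
Lemma osquare_turn p c s q : osquare (p.1 + c, p.2 + s) (- s) c q -> c ^+ 2 + s ^+ 2 = 1 ->
  osquare p c s q.
Proof. by rewrite /osquare/= => -[/andP[? ?] /andP[? ?]] e; split; apply/andP; split; nra. Qed.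

(** At most three changes of corner suffice, according to the signs of [c] and [s]. The value
    [s' = 0] remains for axis-parallel squares. *)
Lemma osquare_quadrant p c s : c ^+ 2 + s ^+ 2 = 1 ->
  exists p' c' s', [/\ 0 < c', 0 <= s', c' ^+ 2 + s' ^+ 2 = 1 &
    osquare p' c' s' `<=` osquare p c s].
Proof.
move=> e; have e' : (- s) ^+ 2 + c ^+ 2 = 1 by rewrite sqrrN addrC.
have e2 : (- c) ^+ 2 + (- s) ^+ 2 = 1 by rewrite !sqrrN.
have e3 : s ^+ 2 + (- c) ^+ 2 = 1 by rewrite sqrrN addrC.
case: (ltP 0 c) => c0.
  case: (leP 0 s) => s0; first by exists p, c, s; split.
  exists (p.1 + c, p.2 + s), (- s), c; split => //; [lra|lra|].
  by move=> q h; exact: osquare_turn h e.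
case: (ltP 0 s) => s0.
  exists (p.1 + c - s - c, p.2 + s + c - s), (- - s), (- c).
  split; rewrite ?opprK//; first lra.
  move=> q h; apply: osquare_turn => //; apply: osquare_turn => //=.
  by apply: osquare_turn => //=; rewrite opprK.
case: (ltP c 0) => c1.
  exists (p.1 + c - s, p.2 + s + c), (- c), (- s); split => //; [lra|lra|].
  by move=> q h; apply: osquare_turn => //; exact: osquare_turn.
exists (p.1 + c, p.2 + s), (- s), c; split => //; first nra.
by move=> q h; exact: osquare_turn h e.
Qed.

(* Shrinking leaves room to tilt an axis-parallel square, so that [chord] and
   [cap] never divide by 0. *)
Lemma tilt_shrink r p c s : 0 < r < 1 -> c ^+ 2 + s ^+ 2 = 1 ->
  exists p' c' s', [/\ 0 < c', 0 < s', c' ^+ 2 + s' ^+ 2 = 1 &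
    forall q, osquare p' c' s' q -> osquare p c s (r * q.1, r * q.2)].
Proof.
move=> /andP[r0 r1] /(osquare_quadrant p)[p1 [c1 [s1 [c0 s0 e sub]]]].
have rn0 : r != 0 by rewrite gt_eqF.
move: s0; rewrite le_eqVlt => /orP[/eqP s10|s0].
  have c11 : c1 = 1 by nra.
  (* [c2] and [s2] are the cosine and sine of [2 * arctan d]. With this [d], the bounding box of the
     tilted square of side [r] has side [r * (c2 + s2) <= 1]. *)
  pose d := (1 - r) / 2.
  have d0 : 0 < d by rewrite /d; lra.
  have d1 : d < 1 by rewrite /d; lra.
  have n0 : 0 < 1 + d ^+ 2 by nra.
  pose c2 := (1 - d ^+ 2) / (1 + d ^+ 2); pose s2 := 2 * d / (1 + d ^+ 2).
  have c20 : 0 < c2 by rewrite divr_gt0//; nra.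
  have s20 : 0 < s2 by rewrite divr_gt0//; nra.
  have e2 : c2 ^+ 2 + s2 ^+ 2 = 1 by rewrite /c2 /s2; field; rewrite gt_eqF.
  have rcs : r * (c2 + s2) <= 1.
    rewrite /c2 /s2 -mulrDl mulrA ler_pdivrMr// mul1r.
    have -> : r = 1 - 2 * d by rewrite /d; lra.
    nra.
  (* Scaling by [r] puts the centre of this square at that of the original. *)
  exists ((p1.1 + 1 / 2) / r - (c2 - s2) / 2, (p1.2 + 1 / 2) / r - (s2 + c2) / 2), c2, s2.
  split => // q h; apply: sub; move: h; rewrite /osquare/=.
  set u := q.1 - _; set v := q.2 - _ => -[/andP[h1 h2] /andP[h3 h4]].
  set a := u * c2 + v * s2 in h1 h2; set b := v * c2 - u * s2 in h3 h4.
  have q1E : r * q.1 - p1.1 = 1 / 2 + r * ((a - 1 / 2) * c2 - (b - 1 / 2) * s2).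
    have -> : (a - 1 / 2) * c2 - (b - 1 / 2) * s2 =
      u * (c2 ^+ 2 + s2 ^+ 2) - (c2 - s2) / 2 by rewrite /a /b; ring.
    by rewrite e2 /u; field.
  have q2E : r * q.2 - p1.2 = 1 / 2 + r * ((a - 1 / 2) * s2 + (b - 1 / 2) * c2).
    have -> : (a - 1 / 2) * s2 + (b - 1 / 2) * c2 =
      v * (c2 ^+ 2 + s2 ^+ 2) - (c2 + s2) / 2 by rewrite /a /b; ring.
    by rewrite e2 /v; field.
  rewrite q1E q2E -s10 c11 !mulr0 !mulr1 addr0 subr0.
  have rc : 0 < r * c2 by exact: mulr_gt0.
  have rs : 0 < r * s2 by exact: mulr_gt0.
  clearbody a b; split; apply/andP; split; nra.
(* Already tilted: a pure shrinking about the centre. *)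
exists ((p1.1 + (c1 - s1) / 2) / r - (c1 - s1) / 2,
        (p1.2 + (s1 + c1) / 2) / r - (s1 + c1) / 2), c1, s1.
split => // q h; apply: sub; move: h; rewrite /osquare/=.
set u := q.1 - _; set v := q.2 - _ => -[/andP[h1 h2] /andP[h3 h4]].
have -> : r * q.1 - p1.1 = r * u + (1 - r) * (c1 - s1) / 2 by rewrite /u; field.
have -> : r * q.2 - p1.2 = r * v + (1 - r) * (s1 + c1) / 2 by rewrite /v; field.
set a := u * c1 + v * s1 in h1 h2; set b := v * c1 - u * s1 in h3 h4.
have -> : (r * u + (1 - r) * (c1 - s1) / 2) * c1 +
  (r * v + (1 - r) * (s1 + c1) / 2) * s1 = r * a + (1 - r) / 2.
  by rewrite -[in RHS](mulr1 ((1 - r) / 2)) -e /a; ring.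
have -> : (r * v + (1 - r) * (s1 + c1) / 2) * c1 -
  (r * u + (1 - r) * (c1 - s1) / 2) * s1 = r * b + (1 - r) / 2.
  by rewrite -[in RHS](mulr1 ((1 - r) / 2)) -e /b; ring.
by clearbody a b; split; apply/andP; split; nra.
Qed.

Lemma open_osquare p c s : open (osquare p c s).
Proof.
have cf : continuous (fun q : R * R => (q.1 - p.1) * c + (q.2 - p.2) * s).
  by move=> q; apply: cvgD; apply: cvgM; try exact: cvg_cst; apply: cvgB;
    try exact: cvg_cst; [exact: cvg_fst|exact: cvg_snd].
have cg : continuous (fun q : R * R => (q.2 - p.2) * c - (q.1 - p.1) * s).
  by move=> q; apply: cvgB; apply: cvgM; try exact: cvg_cst; apply: cvgB;
    try exact: cvg_cst; [exact: cvg_snd|exact: cvg_fst].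
rewrite (_ : osquare p c s =
  (fun q : R * R => (q.1 - p.1) * c + (q.2 - p.2) * s) @^-1` `]0, 1[ `&`
  (fun q : R * R => (q.2 - p.2) * c - (q.1 - p.1) * s) @^-1` `]0, 1[).
  by apply: openI; apply: open_comp => // *; exact: itv_open.
by apply/seteqP; split => q; rewrite /osquare/= !in_itv.
Qed.

Lemma osquare_sub_interior p t : osquare p (cos t) (sin t) `<=` interior (square 1 p t).
Proof.
rewrite -open_subsetE; last exact: open_osquare.
move=> q [/andP[h1 h2] /andP[h3 h4]].
exists ((q.1 - p.1) * cos t + (q.2 - p.2) * sin t),
       ((q.2 - p.2) * cos t - (q.1 - p.1) * sin t).
split; [by rewrite !ltW|by rewrite !ltW|].
have e := cos2Dsin2 t.
rewrite [LHS]surjective_pairing; congr (_, _).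
  transitivity (p.1 + (q.1 - p.1) * (cos t ^+ 2 + sin t ^+ 2)); last by ring.
  by rewrite e; ring.
transitivity (p.2 + (q.2 - p.2) * (cos t ^+ 2 + sin t ^+ 2)); last by ring.
by rewrite e; ring.
Qed.

Lemma square_coord l P T x :
  square l P T (P.1 + (x.1 * cos T - x.2 * sin T), P.2 + (x.1 * sin T + x.2 * cos T)) ->
  0 <= x.1 <= l /\ 0 <= x.2 <= l.
Proof.
move=> [u [v [hu hv [/addrI e1 /addrI e2]]]].
have e := cos2Dsin2 T.
have -> : x.1 = u.
  rewrite -[LHS]mulr1 -[RHS]mulr1 -e.
  transitivity ((x.1 * cos T - x.2 * sin T) * cos T +
                (x.1 * sin T + x.2 * cos T) * sin T); first by ring.
  by rewrite e1 e2; ring.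
have -> : x.2 = v.
  rewrite -[LHS]mulr1 -[RHS]mulr1 -e.
  transitivity ((x.1 * sin T + x.2 * cos T) * cos T -
                (x.1 * cos T - x.2 * sin T) * sin T); first by ring.
  by rewrite e1 e2; ring.
by [].
Qed.

Lemma packable_lt N k l : (2 <= k)%N -> 0 < l -> packable N l -> l < k%:R ->
  N%:R < k%:R ^+ 2 - 1 :> R.
Proof.
move=> k2 l0 [P [T [p [t [sub disj]]]]] lk.
have k0 : 0 < k%:R :> R by rewrite ltr0n (leq_trans _ k2).
(* The midpoint of [l / k] and 1: [r < 1] leaves room to tilt, while the rescaled container has side
   [l / r], still below [k]. *)
pose r := (l / k%:R + 1) / 2.
have lk1 : l / k%:R < 1 by rewrite ltr_pdivrMr// mul1r.
have lk0 : 0 < l / k%:R by rewrite divr_gt0.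
have r01 : 0 < r < 1 by apply/andP; split; rewrite /r; lra.
have /andP[r0 r1] := r01.
have lr : l < r * k%:R by rewrite -ltr_pdivrMr// /r; lra.
pose psi x : R * R :=
  (P.1 + (x.1 * cos T - x.2 * sin T), P.2 + (x.1 * sin T + x.2 * cos T)).
have H i : exists a : R * R * R * R, [/\ 0 < a.1.2, 0 < a.2, a.1.2 ^+ 2 + a.2 ^+ 2 = 1 &
    forall q, osquare a.1.1 a.1.2 a.2 q ->
      osquare (p i) (cos (t i)) (sin (t i)) (psi (r * q.1, r * q.2))].
  (* The corner of square [i] in the frame of the container, where its angle becomes [t i - T]. *)
  pose p1 := (((p i).1 - P.1) * cos T + ((p i).2 - P.2) * sin T,
              ((p i).2 - P.2) * cos T - ((p i).1 - P.1) * sin T).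
  have [p' [c' [s' [c0 s0 e h]]]] := tilt_shrink p1 r01 (cos2Dsin2 (t i - T)).
  exists (p', c', s'); split => // q /h.
  rewrite /osquare/= cosB sinB.
  set x := r * q.1; set y := r * q.2; have eT := cos2Dsin2 T.
  set C := cos T in eT *; set S := sin T in eT *.
  set c := cos (t i); set s := sin (t i).
  move=> [h1 h2]; split.
    have -> // : (P.1 + (x * C - y * S) - (p i).1) * c +
      (P.2 + (x * S + y * C) - (p i).2) * s =
      (x - p1.1) * (c * C + s * S) + (y - p1.2) * (s * C - c * S).
    transitivity ((P.1 - (p i).1) * c * (C ^+ 2 + S ^+ 2) + (x * C - y * S) * c +
      ((P.2 - (p i).2) * s * (C ^+ 2 + S ^+ 2) + (x * S + y * C) * s)).
      by rewrite eT; ring.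
    by rewrite /p1/= -/C -/S; ring.
  have -> // : (P.2 + (x * S + y * C) - (p i).2) * c -
    (P.1 + (x * C - y * S) - (p i).1) * s =
    (y - p1.2) * (c * C + s * S) - (x - p1.1) * (s * C - c * S).
  transitivity ((P.2 - (p i).2) * c * (C ^+ 2 + S ^+ 2) + (x * S + y * C) * c -
    ((P.1 - (p i).1) * s * (C ^+ 2 + S ^+ 2) + (x * C - y * S) * s)).
    by rewrite eT; ring.
  by rewrite /p1/= -/C -/S; ring.
have [a ha] := choice H.
apply: (@packing_bound R N k (l / r) (fun i => (a i).1.1) (fun i => (a i).1.2)
  (fun i => (a i).2)) => //.
- by rewrite divr_ge0 ?ltW.
- by rewrite ltr_pdivrMr// mulrC.
- by move=> i; case: (ha i).
- move=> i q hq; have [_ _ _ /(_ _ hq) /osquare_sub_interior /interior_subset] := ha i.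
  move=> /sub /square_coord/= [/andP[h1 h2] /andP[h3 h4]].
  rewrite -(pmulr_rge0 q.1 r0) -(pmulr_rge0 q.2 r0) h1 h3.
  by rewrite !ler_pdivlMr// (mulrC q.1) (mulrC q.2) h2 h4.
- move=> i j q hi hj; apply: disj => //; exists (psi (r * q.1, r * q.2)).
  have [_ _ _ /(_ _ hi) /osquare_sub_interior qi] := ha i.
  by have [_ _ _ /(_ _ hj) /osquare_sub_interior qj] := ha j.
Qed.

(** * The grid packing and the exact value *)

Lemma interior_square0 p q : interior (square 1 p 0) q ->
  p.1 < q.1 < p.1 + 1 /\ p.2 < q.2 < p.2 + 1.
Proof.
move=> /nbhs_ballP[e /= e0 H].
have e2 : 0 < e / 2 by rewrite divr_gt0.
have S x : ball q e x -> p.1 <= x.1 <= p.1 + 1 /\ p.2 <= x.2 <= p.2 + 1.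
  move=> /H [u [v []]]; rewrite cos0 sin0 !mulr0 !mulr1 subr0 add0r => hu hv ->/=.
  by rewrite !lerDl !lerD2l.
(* Diagonal moves by [e / 2] stay in the ball and make the weak bounds strict. *)
have [h1 h2] : ball q e (q.1 - e / 2, q.2 - e / 2) /\ ball q e (q.1 + e / 2, q.2 + e / 2).
  split; split => /=;
    rewrite /ball/= ?subKr ?opprD ?addNKr ?addrA ?subrr ?sub0r ?normrN gtr0_norm//;
    lra.
have /= [/andP[? ?] /andP[? ?]] := S _ h1; have /= [/andP[? ?] /andP[? ?]] := S _ h2.
by split; apply/andP; split; lra.
Qed.

Lemma nat_open_unit_inj (m n : nat) (x : R) :
  m%:R < x < m%:R + 1 -> n%:R < x < n%:R + 1 -> m = n.
Proof.
move=> /andP[h1 h2] /andP[h3 h4]; apply/eqP; rewrite eqn_leq -ltnS -[(n <= m)%N]ltnS.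
by rewrite -!(ltr_nat R) -!natr1 (lt_trans h1 h4) (lt_trans h3 h2).
Qed.

Lemma packable_grid k N : (N <= k ^ 2)%N -> @packable R N k%:R.
Proof.
move=> Nk; exists (0, 0), 0, (fun i : 'I_N => ((i %% k)%:R, (i %/ k)%:R)), (fun=> 0).
split=> [i q|i j _ _ [q [/interior_square0/= [hi1 hi2] /interior_square0/= [hj1 hj2]]]].
  have ik : (i < k * k)%N by rewrite (leq_trans (ltn_ord i))// mulnn.
  have k0 : (0 < k)%N by case: k ik {Nk}; rewrite ?muln0.
  have m1 : (i %% k)%:R + 1 <= k%:R :> R by rewrite natr1 ler_nat ltn_pmod.
  have d1 : (i %/ k)%:R + 1 <= k%:R :> R by rewrite natr1 ler_nat ltn_divLR.
  move=> [u [v []]]; rewrite cos0 sin0 !mulr0 !mulr1 subr0 add0r.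
  move=> /andP[u0 u1] /andP[v0 v1] ->.
  exists ((i %% k)%:R + u), ((i %/ k)%:R + v).
  rewrite cos0 sin0 !mulr0 !mulr1 subr0 !add0r; split => //=.
    by rewrite addr_ge0//=; lra.
  by rewrite addr_ge0//=; lra.
(* Overlapping cells share row and column, hence quotient and remainder by [k]. *)
apply: val_inj; rewrite /= (divn_eq i k) (divn_eq j k).
by rewrite (nat_open_unit_inj hi1 hj1) (nat_open_unit_inj hi2 hj2).
Qed.

End reduction.

Theorem corollary1p2 (R : realType) (k : nat) (hk : (2 <= k)%N) :
  s R (k ^ 2 - 1)%N = k%:R.
Proof.
have k0 : 0 < k%:R :> R by rewrite ltr0n (leq_trans _ hk).
have lb l : side_lengths (R := R) (k ^ 2 - 1) l -> k%:R <= l.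
  move=> [l0 pl]; rewrite leNgt; apply/negP => /(packable_lt hk l0 pl).
  by rewrite natrB ?expn_gt0 ?(leq_trans _ hk)// natrX ltxx.
have mem : side_lengths (R := R) (k ^ 2 - 1) k%:R.
  by split => //; apply: packable_grid; exact: leq_subr.
apply: xget_unique => [|l [hl lbl]]; first by split.
by apply/eqP; rewrite eq_le lb// lbl.
Qed.
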